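(* Let $G$ be a group with a surjective homomorphism $f\colon G\to\mathbb{Z}$ whose kernel $F$ is a non-abelian finitely generated free group. Then no lexicographic left-order on $G$ where $\mathbb{Z}$ leads is regular. However, there is a lexicographic left-order on $G$ where $\mathbb{Z}$ leads that is one-counter and that extends to a regular left-order on $G\times\mathbb{Z}$ (i.e. its positive cone is the intersection of $G\times\{0\}$ with the positive cone of a regular left-order on $G\times\mathbb{Z}$).
   Context: A positive cone of a group $H$ is a subsemigroup $P$ with $H=P\sqcup P^{-1}\sqcup\{1\}$; it defines the left-order $a\prec b\iff a^{-1}b\in P$. A lexicographic left-order on $G$ where $\mathbb{Z}$ leads is one with positive cone $f^{-1}(P_{\mathbb{Z}})\cup P_F$, where $P_{\mathbb{Z}}$ is a positive cone of $\mathbb{Z}$ and $P_F$ a positive cone of $F=\ker f$. A left-order on a finitely generated group $H$ is regular (resp. one-counter) if there exist a finite set $X$, a surjective monoid homomorphism $\pi\colon X^*\to H$ and a language $\mathcal{L}\subseteq X^*$ accepted by a finite state automaton (resp. by a nondeterministic pushdown automaton with a single stack symbol) with $\pi(\mathcal{L})$ equal to the positive cone. *)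

(* Defs.v *)
From mathcomp Require Import all_boot all_order all_algebra.
Set Implicit Arguments. Unset Strict Implicit. Unset Printing Implicit Defensive.
Import Order.TTheory GRing.Theory Num.Theory.

Record group := Group {
  gcar :> Type;
  gmul : gcar -> gcar -> gcar;
  ginv : gcar -> gcar;
  gone : gcar;
  gmulA : associative gmul;
  gmul1 : left_id gone gmul;
  gmulV : left_inverse gone ginv gmul }.

Arguments gmul {g}. Arguments ginv {g}. Arguments gone {g}.

Definition int_group : group :=
  @Group int (fun a b => (a + b)%R) (fun a => (- a)%R) 0%R
    (@addrA int) (@add0r int) (@addNr int).

Section Prod.
Variables (G H : group).
Definition pmul (x y : G * H) : G * H := (gmul x.1 y.1, gmul x.2 y.2).
Definition pinv (x : G * H) : G * H := (ginv x.1, ginv x.2).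
Definition pone : G * H := (gone, gone).
Lemma pmulA : associative pmul.
Proof. by move=> [a b] [c d] [e f]; rewrite /pmul /= !gmulA. Qed.
Lemma pmul1 : left_id pone pmul.
Proof. by move=> [a b]; rewrite /pmul /= !gmul1. Qed.
Lemma pmulV : left_inverse pone pinv pmul.
Proof. by move=> [a b]; rewrite /pmul /= !gmulV. Qed.
Definition prod_group : group := Group pmulA pmul1 pmulV.
End Prod.

Definition is_hom_to_Z (G : group) (f : G -> int) :=
  forall x y : G, f (gmul x y) = (f x + f y)%R.

Definition geval (G : group) (X : Type) (phi : X -> G) (w : seq X) : G :=
  foldr (fun x acc => gmul (phi x) acc) gone w.

Definition fletter (G : group) n (b : 'I_n -> G) (l : 'I_n * bool) : G :=
  if l.2 then b l.1 else ginv (b l.1).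
Definition freduced n (w : seq ('I_n * bool)) : bool :=
  sorted (fun a c => (a.1 != c.1) || (a.2 == c.2)) w.
Definition free_basis (G : group) (S : G -> Prop) n (b : 'I_n -> G) :=
  (forall i, S (b i)) /\
  (forall g, S g <-> exists w, geval (fletter b) w = g) /\
  (forall w, freduced w -> w != [::] -> geval (fletter b) w <> gone).
Definition fg_free (G : group) (S : G -> Prop) :=
  exists n (b : 'I_n -> G), free_basis S b.
Definition nonabelian (G : group) (S : G -> Prop) :=
  exists x y : G, S x /\ S y /\ gmul x y <> gmul y x.

Definition is_pos_cone (G : group) (S : G -> Prop) (P : G -> Prop) :=
  (forall x, P x -> S x) /\
  (forall x y, P x -> P y -> P (gmul x y)) /\
  (forall x, S x -> [\/ P x, P (ginv x) | x = gone]) /\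
  (forall x, ~ (P x /\ P (ginv x))) /\ ~ P gone.

Definition lex_cone (G : group) (f : G -> int) (P : G -> Prop) :=
  exists (PZ : int_group -> Prop) (PF : G -> Prop),
    is_pos_cone (fun _ => True) PZ /\ is_pos_cone (fun g => f g = 0%R) PF /\
    forall g, P g <-> (PZ (f g) \/ PF g).

Record dfa (X : finType) := Dfa {
  dstate : finType; dinit : dstate; dtrans : dstate -> X -> dstate;
  dfinal : pred dstate }.
Definition dfa_accepts X (A : dfa X) (w : seq X) : bool :=
  @dfinal X A (foldl (@dtrans X A) (@dinit X A) w).

(** Nondeterministic pushdown automata with a single stack symbol (besides
    the bottom-of-stack marker), i.e. one-counter automata.  The stack
    bottom.A^n is represented by the counter n.  A transition
    (q, a, t, q', k) with a : option X (None = epsilon move) and t the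
    test "top of stack is A" (i.e. 0 < n) pops the top symbol (the bottom
    marker is pushed back) and pushes A^k.  Acceptance by final state. *)
Record oca (X : finType) := Oca {
  ostate : finType; oinit : ostate; ofinal : pred ostate;
  otrans : seq (ostate * option X * bool * ostate * nat) }.

Inductive oca_run (X : finType) (A : oca X) :
    ostate A -> nat -> seq X -> ostate A -> nat -> Prop :=
| oca_nil q n : oca_run q n [::] q n
| oca_eps q n w q' k q'' n'' :
    (q, None, 0 < n, q', k) \in @otrans X A ->
    oca_run q' (n.-1 + k) w q'' n'' -> oca_run q n w q'' n''
| oca_read q x n w q' k q'' n'' :
    (q, Some x, 0 < n, q', k) \in @otrans X A ->
    oca_run q' (n.-1 + k) w q'' n'' -> oca_run q n (x :: w) q'' n''.

Definition oca_accepts X (A : oca X) (w : seq X) : Prop :=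
  exists q n, oca_run (@oinit X A) 0 w q n /\ @ofinal X A q.

Definition regular_cone (G : group) (P : G -> Prop) :=
  exists (X : finType) (phi : X -> G),
    (forall g, exists w, geval phi w = g) /\
    exists A : dfa X, forall g, P g <-> exists w, dfa_accepts A w /\ geval phi w = g.

Definition one_counter_cone (G : group) (P : G -> Prop) :=
  exists (X : finType) (phi : X -> G),
    (forall g, exists w, geval phi w = g) /\
    exists A : oca X, forall g, P g <-> exists w, oca_accepts A w /\ geval phi w = g.

(* Main.v *)
Require Import Defs.
From mathcomp Require Import all_boot all_order all_algebra zify.
From Stdlib Require Import Classical.
Set Implicit Arguments. Unset Strict Implicit. Unset Printing Implicit Defensive.
Import Order.TTheory GRing.Theory Num.Theory.

(** No lexicographic order is regular: let L be a regular language representing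
    the cone. On prefixes of words of L that represent elements of F the map f
    is bounded, so correcting these prefixes by finitely many elements gives
    paths in F with bounded steps that join 1 to any positive element of F and
    stay at bounded distance from the positive cone P_F. Such a path enters the
    subtree behind a vertex g of the Cayley tree only near g. If g is chosen so
    that a large ball around it is negative, the whole subtree behind g is
    negative; two translates of this subtree cover F, which is then bounded
    above, a contradiction.

    A one-counter order: let tau(w) be the sum of the signs of the edges and of
    the turns along the path w in the Cayley tree (Dicks and Sunic). It is odd
    for w nontrivial, tau(w^-1) = - tau(w), and it is a quasimorphism of defect
    at most 1, so tau(w) + 2 m > 0 defines a positive cone of F x Z. Since tau
    is a sum of local terms, each letter of w can be given a shift in Z that
    compensates the change of tau, and this makes the cone regular. Counting
    the Z-component of the words in this regular language yields the one-counter
    automaton for the slice m = 0. *)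

(** * Groups and homomorphisms to the integers *)

Section GroupLemmas.
Variable G : group.
Implicit Types x y z : G.

Lemma gmulVr x : gmul x (ginv x) = gone.
Proof.
rewrite -[LHS]gmul1 -{1}(gmulV (ginv x)) -gmulA.
by rewrite [gmul (ginv x) (gmul _ _)]gmulA gmulV gmul1 gmulV.
Qed.

Lemma gmul1r x : gmul x gone = x.
Proof. by rewrite -(gmulV x) gmulA gmulVr gmul1. Qed.

Lemma gmulK x y : gmul (ginv x) (gmul x y) = y.
Proof. by rewrite gmulA gmulV gmul1. Qed.

Lemma gmulVK x y : gmul x (gmul (ginv x) y) = y.
Proof. by rewrite gmulA gmulVr gmul1. Qed.

Lemma gmul_eq1 x y : gmul x y = gone -> y = ginv x.
Proof. by move=> e; rewrite -[y](gmulK x) e gmul1r. Qed.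

Lemma ginvK x : ginv (ginv x) = x.
Proof. by rewrite -(gmul_eq1 (gmulV x)). Qed.

Lemma ginv1 : ginv (@gone G) = gone.
Proof. by rewrite -(gmul_eq1 (gmul1 (@gone G))). Qed.

Lemma ginvM x y : ginv (gmul x y) = gmul (ginv y) (ginv x).
Proof. by apply/esym/gmul_eq1; rewrite -gmulA gmulVK gmulVr. Qed.

Variables (X : Type) (phi : X -> G).

Lemma geval_cat (u v : seq X) :
  geval phi (u ++ v) = gmul (geval phi u) (geval phi v).
Proof. by elim: u => [|a u IH] /=; rewrite ?gmul1 // IH gmulA. Qed.

Lemma geval_rcons (u : seq X) a :
  geval phi (rcons u a) = gmul (geval phi u) (phi a).
Proof. by rewrite -cats1 geval_cat /= gmul1r. Qed.

End GroupLemmas.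

Section HomToZ.
Local Open Scope ring_scope.
Variables (G : group) (f : G -> int).
Hypothesis hf : is_hom_to_Z f.

Lemma hom1 : f gone = 0.
Proof. by have := hf gone gone; rewrite gmul1; lia. Qed.

Lemma homV x : f (ginv x) = - f x.
Proof. by have := hf (ginv x) x; rewrite gmulV hom1; lia. Qed.

End HomToZ.

(** * Reduced words *)

Section ReducedWords.
Variable n : nat.
Local Notation letter := ('I_n * bool)%type.
Implicit Types (l : letter) (u v w : seq letter).

Definition linv l : letter := (l.1, ~~ l.2).
Definition winv w := rev (map linv w).

Lemma linvK : involutive linv.
Proof. by case=> i b; rewrite /linv /= negbK. Qed.

Lemma winvK : involutive winv.
Proof. by move=> w; rewrite /winv map_rev revK (mapK linvK). Qed.

Lemma winv_cons l w : winv (l :: w) = rcons (winv w) (linv l).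
Proof. by rewrite /winv /= rev_cons. Qed.

Lemma winv_rcons w l : winv (rcons w l) = linv l :: winv w.
Proof. by rewrite /winv map_rcons rev_rcons. Qed.

Lemma size_winv w : size (winv w) = size w.
Proof. by rewrite /winv size_rev size_map. Qed.

Lemma freduced_winv w : freduced w -> freduced (winv w).
Proof.
rewrite /freduced /winv rev_sorted sorted_map; apply: sub_sorted => a c /=.
by rewrite /relpre /= eq_sym (inj_eq negb_inj) [c.2 == _]eq_sym.
Qed.

Lemma nocancelE l l' : (l.1 != l'.1) || (l.2 == l'.2) = (l' != linv l).
Proof.
case: l l' => i b [j c]; rewrite /linv /= xpair_eqE negb_and eq_sym.
by case: b c => [] [].
Qed.

Lemma freduced_rcons_cons u l l' v :
  freduced (rcons u l ++ l' :: v) =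
    [&& freduced (rcons u l), l' != linv l & freduced (l' :: v)].
Proof.
rewrite -nocancelE; case: u => [|a u] //=.
by rewrite cat_path last_rcons.
Qed.

Lemma freduced_cat u v : freduced (u ++ v) -> freduced u /\ freduced v.
Proof.
case/lastP: u => [|u l] //; case: v => [|l' v]; first by rewrite cats0.
by rewrite freduced_rcons_cons => /and3P[].
Qed.

(** The last letter of u is cancelled against the first letter of v as long as possible; c is the
    leg of the Cayley tree along which the two paths overlap. *)
Lemma freduced_cancel u v : freduced u -> freduced v ->
  exists a c b, [/\ u = a ++ c, v = winv c ++ b & freduced (a ++ b)].
Proof.
elim/last_ind: u v => [|u l IH] v ru rv; first by exists [::], [::], v.
case: v rv => [|l' v] rv; first by exists (rcons u l), [::], [::]; rewrite cats0.
have [e|ne] := eqVneq l' (linv l); last first.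
  exists (rcons u l), [::], (l' :: v); rewrite cats0; split=> //.
  by rewrite freduced_rcons_cons ru ne.
have ru' : freduced u by move: ru; rewrite -cats1 => /freduced_cat[].
have rv' : freduced v by move: rv; rewrite -cat1s => /freduced_cat[].
have [a [c [b [-> -> rab]]]] := IH _ ru' rv'.
by exists a, (rcons c l), b; split=> //; rewrite ?rcons_cat // winv_rcons e.
Qed.

End ReducedWords.

(** * Evaluation of words in a free basis *)

Section FreeBasis.
Variables (G : group) (n : nat) (b : 'I_n -> G).
Local Notation ev := (geval (fletter b)).
Implicit Types (l : 'I_n * bool) (u v w : seq ('I_n * bool)).

Lemma fletter_linv l : fletter b (linv l) = ginv (fletter b l).
Proof. by case: l => i [] //=; rewrite /fletter /= ginvK. Qed.

Lemma geval_winv w : ev (winv w) = ginv (ev w).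
Proof.
elim: w => [|l w IH]; first by rewrite ginv1.
by rewrite winv_cons geval_rcons IH fletter_linv ginvM.
Qed.

Lemma geval_cancel u v w : gmul (ev (u ++ v)) (ev (winv v ++ w)) = ev (u ++ w).
Proof. by rewrite !geval_cat geval_winv -gmulA gmulVK. Qed.

Lemma freduced_exists w :
  exists v, [/\ freduced v, ev v = ev w & size v <= size w].
Proof.
elim: w => [|l w [v [rv ev_v sv]]]; first by exists [::].
have [a [c [d [e1 e2 r]]]] := @freduced_cancel n [:: l] v isT rv.
exists (a ++ d); split=> //.
  by rewrite -(geval_cancel a c d) -e1 -e2 ev_v /= gmul1r.
have := congr1 size e1; rewrite e2 in sv; move: sv.
by rewrite !size_cat size_winv /=; lia.
Qed.

Hypothesis free : forall w, freduced w -> w != [::] -> ev w <> gone.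

Lemma freduced_eval1 w : freduced w -> ev w = gone -> w = [::].
Proof. by move=> r e; case: (eqVneq w [::]) => // /(free r). Qed.

End FreeBasis.

(** * Coarse connectedness of regular cones *)

Lemma prefix_crossing (T : Type) (A : seq T -> Prop) (w : seq T) :
  ~ A [::] -> A w -> exists u x v, [/\ w = rcons u x ++ v, ~ A u & A (rcons u x)].
Proof.
move=> A0; elim/last_ind: w => [//|w x IH] Aw.
have [Aw'|nA] := classic (A w); last by exists w, x, [::]; rewrite cats0.
have [u [y [v [-> nu Au]]]] := IH Aw'.
by exists u, y, (rcons v x); rewrite rcons_cat.
Qed.

(** Turns a choice made separately for each state or letter into one uniform constant. *)
Lemma fin_bound (I : finType) (p : I -> nat -> Prop) :
  (forall i m k, m <= k -> p i m -> p i k) -> (forall i, exists m, p i m) ->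
  exists m, forall i, p i m.
Proof.
move=> mono /fin_all_exists[m Hm].
by exists (\max_i m i) => i; apply: mono (Hm i); apply: leq_bigmax.
Qed.

Section LeftOrderedFreeGroup.
Variables (G : group) (S : G -> Prop) (n : nat) (b : 'I_n -> G).
Hypothesis basis : free_basis S b.
Hypothesis nonab : nonabelian S.
Variable P : G -> Prop.
Hypothesis cone : is_pos_cone S P.
Local Notation ev := (geval (fletter b)).

Lemma basis_eval w : S (ev w).
Proof. by case: basis => _ [H _]; apply/H; exists w. Qed.

Lemma basis_word g : S g -> exists w, ev w = g.
Proof. by case: basis => _ [H _] /H. Qed.

Lemma basis_sub1 : S gone. Proof. exact: (basis_eval [::]). Qed.

Lemma basis_subM x y : S x -> S y -> S (gmul x y).
Proof.
by move=> /basis_word[u <-] /basis_word[v <-]; rewrite -geval_cat; apply: basis_eval.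
Qed.

Lemma basis_subV x : S x -> S (ginv x).
Proof. by move=> /basis_word[u <-]; rewrite -geval_winv; apply: basis_eval. Qed.

Lemma cone_inhabited : exists p, P p.
Proof.
case: cone => _ [_ [tot _]]; case: nonab => x [y [Sx [Sy ne]]].
case: (tot x Sx) => [Px|Px|x1]; [by exists x|by exists (ginv x)|].
by case: ne; rewrite x1 gmul1 gmul1r.
Qed.

(** This is a strict upper bound in the left-order. The bound M is kept if it exceeds the next
    element; otherwise it moves up by right multiplication with a positive p, since k is below k
    p. *)
Lemma upper_bound (I : finType) (k : I -> G) : (forall i, S (k i)) ->
  exists2 M, S M & forall i, P (gmul (ginv (k i)) M).
Proof.
case: (cone) => PS [PM [tot _]] Sk.
have [p Pp] := cone_inhabited.
suff H (s : seq I) : exists2 M, S M & forall i, i \in s -> P (gmul (ginv (k i)) M).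
  have [M SM HM] := H (enum I).
  by exists M => // i; apply: HM; rewrite mem_enum.
elim: s => [|i s [M SM IH]]; first by exists gone => //; apply: basis_sub1.
have SkM : S (gmul (ginv (k i)) M) by apply/basis_subM/SM/basis_subV.
have [Plt|Pgt|eq1] := tot _ SkM.
- by exists M => // j; rewrite inE => /orP[/eqP -> | /IH].
- exists (gmul (k i) p) => [|j]; first by apply: basis_subM => //; apply: PS.
  rewrite inE => /orP[/eqP -> | /IH Pj]; first by rewrite gmulK.
  have := PM _ _ (PM _ _ Pj Pgt) Pp; rewrite ginvM ginvK -!gmulA.
  by rewrite gmulVK.
- have eM : M = k i by rewrite (gmul_eq1 eq1) ginvK.
  exists (gmul M p) => [|j]; first by apply: basis_subM => //; apply: PS.
  rewrite inE => /orP[/eqP -> | /IH Pj]; first by rewrite eM gmulK.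
  by rewrite gmulA; apply: PM.
Qed.

(** A single generator would make the group cyclic, hence abelian. *)
Lemma other_generator (i : 'I_n) : exists j : 'I_n, j != i.
Proof.
apply: NNPP => nex; case: nonab => x [y [/basis_word[u <-] [/basis_word[v <-]]]].
have eqi j : j = i by apply/eqP/negPn/negP => ne; apply: nex; exists j.
have comm l l' : gmul (fletter b l) (fletter b l') = gmul (fletter b l') (fletter b l).
  case: l l' => [j s] [j' s']; rewrite /fletter /= (eqi j) (eqi j').
  by case: s s' => [] []; rewrite ?gmulV ?gmulVr.
have comm1 l w : gmul (fletter b l) (ev w) = gmul (ev w) (fletter b l).
  elim: w => [|l' w IH] /=; first by rewrite gmul1 gmul1r.
  by rewrite gmulA comm -!gmulA IH.
case; elim: u => [|l u IH] /=; first by rewrite gmul1 gmul1r.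
by rewrite -gmulA IH gmulA comm1 gmulA.
Qed.

(** The subtree of the Cayley tree behind the vertex [ev pre], seen from 1. *)
Definition has_prefix (pre : seq ('I_n * bool)) (g : G) :=
  exists d, freduced (pre ++ d) /\ ev (pre ++ d) = g.

(** If the part d beyond [pre] were longer than w, multiplying by the inverse of w could not reach
    into [pre], and h would already lie in the subtree. *)
Lemma leave_prefix pre h w : has_prefix pre (gmul h (ev w)) -> ~ has_prefix pre h ->
  exists2 d, size d <= size w & gmul h (ev w) = ev (pre ++ d).
Proof.
move=> [d [rd ed]] nh; exists d => //; rewrite leqNgt; apply/negP => lt_wd; apply: nh.
have [v [rv ev_v sv]] := freduced_exists b (winv w).
have [a [c [e [e1 e2 r]]]] := freduced_cancel rd rv.
have eh : h = ev (a ++ e).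
  by rewrite -(geval_cancel b a c e) -e1 -e2 ev_v ed geval_winv -gmulA gmulVr gmul1r.
have sc : size c <= size d.
  by rewrite e2 size_cat !size_winv in sv; lia.
have pa : size pre <= size a.
  by have := congr1 size e1; rewrite !size_cat; lia.
exists (drop (size pre) a ++ e).
suff -> : pre ++ drop (size pre) a ++ e = a ++ e by split.
have := congr1 (take (size pre)) e1; rewrite take_size_cat // takel_cat // => E.
by rewrite catA {1}E cat_take_drop.
Qed.

(* The positive cone of a nonabelian free group is not coarsely connected: a
   path from 1 with bounded steps enters the subtree behind a vertex g only
   near g, so if a large ball around g is negative then the whole subtree is,
   and two translates of this subtree cover the group. *)
Lemma cone_not_coarsely_connected (R : nat) :
  ~ (forall (A : G -> Prop) p, ~ A gone -> P p -> A p ->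
       exists h d e, [/\ size d <= R, size e <= R, ~ A h, A (gmul h (ev d)) &
                         P (gmul (gmul h (ev d)) (ev e))]).
Proof.
move=> conn; case: (cone) => PS [PM [tot [asym P1]]].
case: (basis) => _ [_ free].
(* The vertex is the inverse of M: the inverse of M^-1 d is d^-1 M, which is positive for d in the
   ball of radius 2R. One R pays for the step into the subtree, the other for the distance to the
   cone. *)
have [M SM HM] := @upper_bound {bseq (R + R) of 'I_n * bool} (fun s => ev s)
  (fun s => basis_eval s).
have [w ew] := basis_word (basis_subV SM).
have [pre [rpre epre _]] := freduced_exists b w.
have ball d : size d <= R + R -> ~ P (ev (pre ++ d)).
  move=> sd Pd; apply: (asym (ev (pre ++ d))); split=> //.
  by rewrite geval_cat ginvM epre ew ginvK; apply: (HM (Bseq sd)).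
(* A positive element here would force a path from 1 to enter the subtree within R of its root, and
   a positive element would lie within R of the entry, inside the negative ball. *)
have subtree d : freduced (pre ++ d) -> ~ P (ev (pre ++ d)).
  move=> rd Pd.
  have pre0 : pre != [::].
    apply/eqP => pre0; apply: P1; have := HM (Bseq (isT : size [::] <= _)).
    by rewrite /= ginv1 gmul1 -[M]ginvK -ew -epre pre0 /= ginv1.
  have n1 : ~ has_prefix pre gone.
    move=> [c [rc /(freduced_eval1 free rc)]].
    by case: (pre) pre0.
  have [|h [c [e [sc se nh hh Phe]]]] := conn (has_prefix pre) _ n1 Pd.
    by exists d.
  have [c' sc' ec'] := leave_prefix hh nh.
  apply: (@ball (c' ++ e)); first by rewrite size_cat leq_add // (leq_trans sc').
  by rewrite catA geval_cat -ec'.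
case/lastP: pre rpre epre subtree {ball} => [|pre x] rpre epre subtree.
  have [p Pp] := cone_inhabited; have [v ev_v] := basis_word (PS _ Pp).
  have [u [ru eu _]] := freduced_exists b v.
  by apply: (subtree u) => //=; rewrite eu ev_v.
(* Choose h, with reduced word u, such that both g h and g y h are positive. If u does not start
   with the inverse of x, then g h lies in the negative subtree; if it does, y u is reduced and g y
   h lies there. *)
have [j nj] := other_generator x.1.
pose y : 'I_n * bool := (j, true).
pose g := ev (rcons pre x).
have [h Sh Hh] := @upper_bound bool
  (fun s => if s then ginv g else ginv (gmul g (fletter b y)))
  (fun s => ltac:(case: s; apply: basis_subV; rewrite /g -?geval_rcons;
                  apply: basis_eval)).
have [v ev_v] := basis_word Sh; have [u [ru eu _]] := freduced_exists b v.
have /negP ncancel : ~~ freduced (rcons pre x ++ u).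
  by apply/negP => r; apply: (subtree u r); rewrite geval_cat eu ev_v;
     have := Hh true; rewrite /= ginvK.
apply: (subtree (y :: u)).
  rewrite freduced_rcons_cons; apply/and3P; split=> //.
    by rewrite -nocancelE /= eq_sym nj.
  case: u ru ncancel {eu} => [//|l u] ru.
  rewrite freduced_rcons_cons rpre ru andbT /= => /negP/negPn/eqP E.
  change (freduced (rcons [::] y ++ l :: u)).
  by rewrite freduced_rcons_cons ru -nocancelE E /= nj.
rewrite geval_cat /= eu ev_v gmulA.
by have := Hh false; rewrite /= ginvK.
Qed.

End LeftOrderedFreeGroup.

(** * From accepted words to paths in the kernel *)

Section RegularLexCone.
Local Open Scope ring_scope.
Variables (G : group) (f : G -> int) (S PF P : G -> Prop).
Hypothesis hf : is_hom_to_Z f.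
Hypothesis fsurj : forall z, exists g, f g = z.
Hypothesis kerf : forall g, S g <-> f g = 0.
Hypothesis cone : is_pos_cone S PF.
Hypothesis lexP : forall g, P g <-> 0 < f g \/ PF g.
Variables (n : nat) (b : 'I_n -> G).
Hypothesis basis : free_basis S b.
Variables (X : finType) (phi : X -> G) (D : dfa X).
Hypothesis recP : forall g, P g <-> exists w, dfa_accepts D w /\ geval phi w = g.
Local Notation ev := (geval (fletter b)).
Local Notation F w := (f (geval phi w)).
Local Notation run q w := (foldl (@dtrans X D) q w).
Local Notation acc q w := (dfinal (run q w)).

Lemma accepted_ge0 w : acc (dinit D) w -> 0 <= F w.
Proof.
move=> aw; have /lexP[/ltW //|/(proj1 cone) /kerf ->//] : P (geval phi w).
by apply/recP; exists w.
Qed.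

Lemma hom_cat u v : F (u ++ v) = F u + F v.
Proof. by rewrite geval_cat hf. Qed.

(* A prefix u of an accepted word w = uv can be completed to an accepted word
   by one of finitely many words, and so can the suffix v; as f is nonnegative
   on accepted words, this bounds f below on u and on v. *)
Lemma prefix_bound : exists K : nat, forall u v, acc (dinit D) (u ++ v) ->
  F (u ++ v) = 0 -> `|F u| <= K%:Z.
Proof.
have [||K1 HK1] := @fin_bound (dstate D) (fun q m =>
  (exists v, acc q v) -> exists2 v, acc q v & F v <= m%:Z).
- by move=> q m k mk H /H[v av lv]; exists v => //; lia.
- move=> q; have [[v av]|nex] := classic (exists v, acc q v); last by exists 0%N.
  by exists (absz (F v)) => _; exists v => //; lia.
have [||K2 HK2] := @fin_bound (dstate D) (fun q m =>
  (exists u, run (dinit D) u = q) -> exists2 u, run (dinit D) u = q & F u <= m%:Z).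
- by move=> q m k mk H /H[v av lv]; exists v => //; lia.
- move=> q; have [[v av]|nex] := classic (exists v, run (dinit D) v = q).
    by exists (absz (F v)) => _; exists v => //; lia.
  by exists 0%N.
exists (K1 + K2)%N => u v auv; rewrite hom_cat => e.
have [|v' av' lv'] := HK1 (run (dinit D) u); first by exists v; rewrite -foldl_cat.
have [|u' eu' lu'] := HK2 (run (dinit D) u); first by exists u.
have := @accepted_ge0 (u ++ v'); rewrite foldl_cat hom_cat => /(_ av').
have := @accepted_ge0 (u' ++ v); rewrite foldl_cat hom_cat eu' -foldl_cat => /(_ auv).
by lia.
Qed.

(** A prefix u of a word for p is moved into F by a correction that depends only on [F u], which
    takes finitely many values. Consecutive points of this path then differ by one of finitely many
    elements, and so do path points and suitable positive elements of F. *)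
Lemma regular_cone_coarsely_connected : exists R : nat,
  forall (A : G -> Prop) p, ~ A gone -> PF p -> A p ->
    exists h d e, [/\ (size d <= R)%N, (size e <= R)%N, ~ A h, A (gmul h (ev d)) &
                      PF (gmul (gmul h (ev d)) (ev e))].
Proof.
have [K HK] := prefix_bound.
(* [I] indexes the integers from -K to K; [z] decodes and [idx] encodes. *)
pose I := 'I_(K + K).+1.
pose z (i : I) : int := i%:Z - K%:Z.
pose idx (m : int) : I := inord (absz (m + K%:Z)).
have idxK m : `|m| <= K%:Z -> z (idx m) = m.
  by move=> le; rewrite /z /idx inordK; lia.
(* A section of f on this range; sending 0 to 1 makes the path start at 1 and end at p. *)
have [s Hs] : exists s : I -> G, forall i, f (s i) = z i /\ (z i = 0 -> s i = gone).
  apply: (@fin_all_exists I (fun _ => G) (fun i g => f g = z i /\ (z i = 0 -> g = gone))).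
  move=> i; have [->|ne] := eqVneq (z i) 0; first by exists gone; rewrite hom1.
  by have [g eg] := fsurj (z i); exists g; split=> // e; rewrite e in ne.
have Ss g : f g = 0 -> exists w, ev w = g by move=> /kerf /(basis_word basis).
have [||R1 HR1] := @fin_bound (I * I * X)%type (fun t m => let: (i, j, x) := t in
  z i + f (phi x) = z j ->
  exists2 w, ev w = gmul (s i) (gmul (phi x) (ginv (s j))) & (size w <= m)%N).
- by move=> [[i j] x] m k mk H /H[w ew sw]; exists w => //; lia.
- move=> [[i j] x]; have [e|ne] := eqVneq (z i + f (phi x)) (z j); last first.
    by exists 0%N => e; rewrite e eqxx in ne.
  have [|w ew] := Ss (gmul (s i) (gmul (phi x) (ginv (s j)))).
    by rewrite !hf homV // (Hs i).1 (Hs j).1; lia.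
  by exists (size w) => _; exists w.
(* For each state and height, one completion to an accepted word of total height 0 is fixed. *)
have [||R2 HR2] := @fin_bound (dstate D * I)%type (fun t m => let: (q, i) := t in
  (exists2 v, acc q v & z i + F v = 0) ->
  exists v w, [/\ acc q v, z i + F v = 0,
    ev w = gmul (s i) (geval phi v) & (size w <= m)%N]).
- by move=> [q i] m k mk H /H[v [w [av ev_v ew sw]]]; exists v, w; split=> //; lia.
- move=> [q i]; have [[v av e]|nex] := classic (exists2 v, acc q v & z i + F v = 0);
    last by exists 0%N.
  have [|w ew] := Ss (gmul (s i) (geval phi v)); first by rewrite hf (Hs i).1.
  by exists (size w) => _; exists v, w.
exists (R1 + R2)%N => A p A1 PFp Ap.
have /recP[w [aw ew]] : P p by apply/lexP; right.
have fw : F w = 0 by rewrite ew; apply/kerf; apply: (proj1 cone).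
pose h u := gmul (geval phi u) (ginv (s (idx (F u)))).
have h0 u : F u = 0 -> h u = geval phi u.
  move=> e; rewrite /h e; have [_ ->] := Hs (idx 0); first by rewrite ginv1 gmul1r.
  by rewrite idxK //; lia.
have [||u [x [v [ewu nu Au]]]] := @prefix_crossing _ (A \o h) w.
- by rewrite /= h0 //= ?hom1.
- by rewrite /= h0 // ew.
rewrite {}ewu in aw fw {ew}.
have bx := HK _ _ aw fw.
have bu : `|F u| <= K%:Z by apply: (HK u (x :: v)); rewrite -cat_rcons.
have [|d ed sd] := HR1 (idx (F u), idx (F (rcons u x)), x).
  by rewrite !idxK // geval_rcons hf.
have [|v' [e [av' Fv' ee se]]] := HR2 (run (dinit D) (rcons u x), idx (F (rcons u x))).
  by exists v; [rewrite -foldl_cat | rewrite idxK // -hom_cat].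
have step : gmul (h u) (ev d) = h (rcons u x).
  by rewrite /h ed -gmulA gmulK geval_rcons -gmulA.
exists (h u), d, e; rewrite step; split=> //; [lia|lia|].
have -> : gmul (h (rcons u x)) (ev e) = geval phi (rcons u x ++ v').
  by rewrite /h ee -gmulA gmulK -geval_cat.
rewrite idxK // -hom_cat in Fv'.
have /lexP[|//] : P (geval phi (rcons u x ++ v')).
  by apply/recP; exists (rcons u x ++ v'); rewrite /dfa_accepts foldl_cat.
by rewrite Fv'.
Qed.

End RegularLexCone.

(** * Cones of the integers and non-regularity *)

Section LexNotRegular.
Local Open Scope ring_scope.

(** Totality puts 1 or -1 in the cone, closure adds its positive multiples, and asymmetry excludes
    everything else. *)
Lemma int_cone (Z : int_group -> Prop) : is_pos_cone (fun _ => True) Z ->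
  (forall z, Z z <-> 0 < (z : int)) \/ (forall z, Z z <-> 0 < - (z : int)).
Proof.
move=> [_ [ZM [tot [asym Z1]]]].
have mulS (e : int) (m : nat) : Z e -> Z (e *+ m.+1).
  by move=> Ze; elim: m => [|m IH] //; rewrite mulrS; apply: ZM.
have sub (e : int) : `|e| = 1 -> Z e -> forall z : int, Z z <-> 0 < e * z.
  move=> e1 Ze z.
  have pos (y : int) : 0 < e * y -> Z y.
    move=> lt; have -> : y = e *+ ((absz (e * y)).-1).+1.
      rewrite prednK ?absz_gt0 ?gt_eqF // -mulr_natr natz gtz0_abs //.
      by rewrite mulrA -expr2 -real_normK ?num_real // e1 expr1n mul1r.
    exact: mulS.
  split=> [Zz|]; last exact: pos.
  rewrite ltNge; apply/negP; rewrite le_eqVlt => /orP[/eqP e0|lt0].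
    suff z0 : z = 0 by apply: Z1; move: Zz; rewrite z0.
    by apply/eqP; move/eqP: e0; rewrite mulf_eq0 -normr_eq0 e1.
  by apply: (asym z); split=> //; apply: (pos (- z)); rewrite mulrN oppr_gt0.
have [Z1'|Z1'|//] := tot (1 : int) I.
- by left=> z; rewrite (sub 1 (normr1 _) Z1') mul1r.
- by right=> z; rewrite (sub (-1) _ Z1') ?normrN1 // mulN1r.
Qed.

Lemma lex_cone_not_regular (G : group) (f : G -> int) (P : G -> Prop) :
  is_hom_to_Z f -> (forall z, exists g, f g = z) ->
  fg_free (fun g => f g = 0) -> nonabelian (fun g => f g = 0) ->
  lex_cone f P -> ~ regular_cone P.
Proof.
move=> hf fsurj [n [b basis]] nonab [PZ [PF [coneZ [coneF lexP]]]].
move=> [X [phi [_ [D recP]]]].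
suff [R] : exists R : nat, forall (A : G -> Prop) p, ~ A gone -> PF p -> A p ->
    exists h d e, [/\ (size d <= R)%N, (size e <= R)%N, ~ A h,
       A (gmul h (geval (fletter b) d)) &
       PF (gmul (gmul h (geval (fletter b) d)) (geval (fletter b) e))].
  exact: (cone_not_coarsely_connected basis nonab coneF).
have [PZE|PZE] := int_cone coneZ.
- apply: (regular_cone_coarsely_connected hf fsurj _ coneF _ basis recP) => // g.
  by rewrite lexP PZE.
(* The reversed order of the integers is handled by -f, which has the same kernel. *)
- apply: (@regular_cone_coarsely_connected _ (fun g => - f g) _ _ P _ _ _ coneF
    _ _ _ basis _ _ _ recP).
  + by move=> x y; rewrite hf opprD.
  + by move=> z; have [g eg] := fsurj (- z); exists g; rewrite eg opprK.
  + by move=> g; split=> [->|]; lia.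
  + by move=> g; rewrite lexP PZE.
Qed.

End LexNotRegular.

(** * Slices of regular languages *)

Lemma geval_prod (G H : group) (X : Type) (phi : X -> prod_group G H) w :
  geval phi w = (geval (fun x => (phi x).1) w, geval (fun x => (phi x).2) w).
Proof. by elim: w => [|x w IH] //=; rewrite IH. Qed.

Definition dfa_union (X : finType) (A B : dfa X) : dfa X :=
  @Dfa X (dstate A * dstate B)%type (dinit A, dinit B)
    (fun q x => (dtrans q.1 x, dtrans q.2 x))
    (fun q => dfinal q.1 || dfinal q.2).

Lemma dfa_unionP (X : finType) (A B : dfa X) w :
  dfa_accepts (dfa_union A B) w = dfa_accepts A w || dfa_accepts B w.
Proof.
rewrite /dfa_accepts; set u := foldl _ (dinit (dfa_union A B)) w.
suff -> : u = (foldl (@dtrans X A) (dinit A) w, foldl (@dtrans X B) (dinit B) w) by [].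
rewrite /u /=; elim: w (dinit A) (dinit B) {u} => [|x w IH] p q //=.
Qed.

Section OneCounter.
Local Open Scope ring_scope.
Variables (G : group) (X : finType) (phi : X -> prod_group G int_group).
Variable D : dfa X.
Hypothesis phi2 : forall x, [|| (phi x).2 == 0 :> int, (phi x).2 == 1 :> int
                              | (phi x).2 == -1 :> int].
Local Notation shift := (geval (fun x => (phi x).2)).
Local Notation state := (option (dstate D * bool)).

Definition counter_value (s : bool) (m : nat) : int := if s then m%:Z else - m%:Z.

(** The second component counts the pushes after a pop, and the pop removes a symbol only if t
    holds: hence t to stay, 0 to decrease and [t.+1] to increase. At counter 0 the sign is chosen
    anew. *)
Definition counter_step (s t : bool) (d : int) : bool * nat :=
  if d == 0 then (s, t : nat)
  else if t && (s != (d == 1)) then (s, 0%N) else (d == 1, t.+1).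

Lemma counter_stepP s m x : let: r := counter_step s (0 < m)%N (phi x).2 in
  counter_value r.1 (m.-1 + r.2)%N = counter_value s m + (phi x).2.
Proof.
rewrite /counter_step /counter_value.
by case/or3P: (phi2 x) => /eqP ->; case: s; case: m => [|m] /=; lia.
Qed.

Definition read_move (p : dstate D * bool * bool * X) :
    state * option X * bool * state * nat :=
  let: (q, s, t, x) := p in
  let: r := counter_step s t (phi x).2 in
  (Some (q, s), Some x, t, Some (dtrans q x, r.1), r.2).

(** The test [false] allows this move only at counter 0, so acceptance by final state also checks
    that the Z-component vanishes. *)
Definition stop_move (p : dstate D * bool) : state * option X * bool * state * nat :=
  (Some p, None, false, None, 0%N).

(* The state [Some (q, s)] with counter m stands for D in state q after
   reading a word whose Z-component is m or - m, according to the sign s. *)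
Definition zero_shift_oca : oca X :=
  @Oca X state (Some (dinit D, true)) (fun st => st == None)
    (codom read_move ++ [seq stop_move p | p <- enum {: dstate D * bool} & dfinal p.1]).

Lemma zero_shift_run_sound (st st' : ostate zero_shift_oca) m m' w :
  oca_run st m w st' m' -> st' = None ->
  match st with
  | None => w = [::]
  | Some (q, s) =>
      dfinal (foldl (@dtrans X D) q w) /\ counter_value s m + shift w = 0
  end.
Proof.
elim=> {st st' m m' w} [st m -> //|st m w st' k st'' m'' tr _ IH e
                       |st x m w st' k st'' m'' tr _ IH e].
  move: tr; rewrite mem_cat => /orP[/codomP[[[[q s] t] y]] //|/mapP[[q s]]].
  rewrite mem_filter => /andP[fq _] [es et est' _]; rewrite est' in IH; rewrite es.
  by rewrite (IH e) /counter_value; case: m et {IH} => [|m] //; case: (s).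
move: tr; rewrite mem_cat => /orP[/codomP[[[[q s] t] y]] |/mapP[[q s]] //].
case=> es <- et est' ek; rewrite est' ek -et in IH; rewrite es.
have [fq] := IH e; rewrite counter_stepP -addrA => e0; split=> //.
Qed.

Lemma zero_shift_run_complete q s m w :
  dfinal (foldl (@dtrans X D) q w) -> counter_value s m + shift w = 0 ->
  exists m', oca_run (A := zero_shift_oca) (Some (q, s)) m w None m'.
Proof.
elim: w q s m => [|x w IH] q s m /= fq e.
  have m0 : m = 0%N by move: e; rewrite /counter_value; case: s; lia.
  exists 0%N; rewrite m0;
  apply: (@oca_eps X zero_shift_oca _ _ _ None 0); last exact: oca_nil.
  rewrite mem_cat; apply/orP; right; apply/mapP; exists (q, s) => //.
  by rewrite mem_filter fq mem_enum.
pose r := counter_step s (0 < m)%N (phi x).2.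
have [||m' run] := IH (dtrans q x) r.1 (m.-1 + r.2)%N => //.
  by rewrite counter_stepP -addrA.
exists m'; apply: oca_read run.
by rewrite mem_cat; apply/orP; left; apply/codomP; exists (q, s, (0 < m)%N, x).
Qed.

Lemma zero_shift_accepts w : oca_accepts zero_shift_oca w <->
  dfa_accepts D w /\ shift w = 0.
Proof.
split=> [[st [m [run /eqP e]]]|[aw e]].
  by have [aw] := zero_shift_run_sound run e; rewrite add0r.
have [|m run] := zero_shift_run_complete (s := true) (m := 0) aw; first by rewrite add0r.
by exists None, m.
Qed.

End OneCounter.

Lemma regular_one_counter (G : group) (Q : prod_group G int_group -> Prop)
    (X : finType) (phi : X -> prod_group G int_group) (D : dfa X) :
  (forall x, [|| (phi x).2 == 0 :> int, (phi x).2 == 1 :> int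
               | (phi x).2 == -1 :> int])%R ->
  (forall g, exists w, geval phi w = g) ->
  (forall g, Q g <-> exists w, dfa_accepts D w /\ geval phi w = g) ->
  one_counter_cone (fun g : G => Q (g, 0%R)).
Proof.
move=> phi2 surj recQ; exists X, (fun x => (phi x).1); split.
  by move=> g; have [w] := surj (g, 0%R); rewrite geval_prod => -[]; exists w.
exists (zero_shift_oca phi D) => g; rewrite recQ; split=> -[w [aw ew]]; exists w.
  by move: ew; rewrite geval_prod zero_shift_accepts // => -[].
by move: aw; rewrite zero_shift_accepts // geval_prod ew => -[? ->].
Qed.

(** * The cone defined by edges and turns *)

Section Tau.
Local Open Scope ring_scope.
Variable n : nat.
Local Notation letter := ('I_n * bool)%type.
Implicit Types (l p q r : letter) (a c w : seq letter) (o : option letter).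

Definition eps l : int := if l.2 then 1 else -1.

Definition turn p q : int :=
  ((enum_rank p < enum_rank q)%N : nat)%:Z - ((enum_rank q < enum_rank p)%N : nat)%:Z.

(** [None] is the missing direction at an end of a path, where there is no turn. *)
Definition oturn o o' : int :=
  if o is Some p then if o' is Some q then turn p q else 0 else 0.

(* In the Cayley tree every edge contributes a sign according to its
   orientation, and every interior vertex of the path w contributes the sign of
   the turn there, for a fixed linear order on the 2n directions at a vertex. *)
Fixpoint tau w : int :=
  if w is l :: w' then eps l + oturn (Some (linv l)) (ohead w') + tau w' else 0.

Lemma turnN p q : turn q p = - turn p q.
Proof. by rewrite /turn opprB. Qed.

Lemma oturnN o o' : oturn o' o = - oturn o o'.
Proof. by case: o o' => [p|] [q|] //=; rewrite turnN. Qed.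

Lemma turn_sign p q : p != q -> turn p q = 1 \/ turn p q = -1.
Proof.
move=> ne; rewrite /turn.
have : (enum_rank p != enum_rank q :> nat).
  by rewrite (inj_eq val_inj) (inj_eq enum_rank_inj).
by case: ltngtP => // _ _; [left|right].
Qed.

(** A linear order has no cycle p < q < r < p, so the three signs cannot all be 1. *)
Lemma oturn_triangle o1 o2 o3 : oturn o1 o2 + oturn o2 o3 - oturn o1 o3 <= 1.
Proof. by case: o1 o2 o3 => [p|] [q|] [r|] //=; rewrite /turn; lia. Qed.

Lemma ohead_winv_cons l a : ohead (winv (l :: a)) =
  if a is [::] then Some (linv l) else ohead (winv a).
Proof.
rewrite winv_cons; case/lastP: a => [|a l'] //; rewrite winv_rcons.
by case: (rcons a l') (size_rcons a l').
Qed.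

(** Only the turn at the junction is new; [ohead (winv a)] is the direction back along a. *)
Lemma tau_cat a c : tau (a ++ c) = tau a + tau c + oturn (ohead (winv a)) (ohead c).
Proof.
elim: a => [|l a IH] /=; first by rewrite addr0 add0r.
rewrite IH ohead_winv_cons; case: a {IH} => [|l' a] /=; lia.
Qed.

Lemma tau_winv w : tau (winv w) = - tau w.
Proof.
elim: w => [|l w IH] //=.
rewrite winv_cons -cats1 tau_cat IH winvK /= (oturnN (Some (linv l))) /eps /=.
by case: l.2 => /=; lia.
Qed.

(** The contributions of c cancel by antisymmetry, which leaves three turns at the branching
    vertex. *)
Lemma tau_defect a c w : tau (a ++ c) + tau (winv c ++ w) <= tau (a ++ w) + 1.
Proof.
rewrite !tau_cat tau_winv winvK.
have := oturn_triangle (ohead (winv a)) (ohead c) (ohead w); lia.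
Qed.

Lemma tau_rcons w l : tau (rcons w l) = tau w + (oturn (ohead (winv w)) (Some l) + eps l).
Proof. by rewrite -cats1 tau_cat /=; lia. Qed.

Lemma eps_sign l : eps l = 1 \/ eps l = -1.
Proof. by rewrite /eps; case: l.2; [left|right]. Qed.

(** A reduced word of length k > 0 has k edges and k - 1 turns, each contributing 1 or -1. *)
Lemma tau_odd w : freduced w -> w != [::] -> exists k : int, tau w = 2 * k + 1.
Proof.
elim: w => [//|l w IH] r _; case: w IH r => [|l' w] IH r.
  by case: (eps_sign l) => /= ->; [exists 0|exists (-1)].
have /and3P[_ nc rw] : [&& true, l' != linv l & freduced (l' :: w)].
  by rewrite -(freduced_rcons_cons [::] l l' w).
have [k ek] := IH rw isT.
rewrite eq_sym in nc.
change (exists k, eps l + turn (linv l) l' + tau (l' :: w) = 2 * k + 1).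
rewrite ek; case: (eps_sign l) (turn_sign nc) => -> [] ->.
- by exists (k + 1); lia.
- by exists k; lia.
- by exists k; lia.
- by exists (k - 1); lia.
Qed.

End Tau.

(** * The positive cone on the product with the integers *)

Section ExtendedCone.
Local Open Scope ring_scope.
Variables (G : group) (f : G -> int).
Hypothesis hf : is_hom_to_Z f.
Variables (n : nat) (b : 'I_n -> G).
Hypothesis basis : free_basis (fun g => f g = 0) b.
Local Notation ev := (geval (fletter b)).
Implicit Types (g h : G) (m k : int).

Definition tau_cone g m :=
  exists w, [/\ freduced w, ev w = g & 0 < tau w + 2 * m].

Definition ext_cone (x : prod_group G int_group) := 0 < f x.1 \/ tau_cone x.1 x.2.

Let free : forall w, freduced w -> w != [::] -> ev w <> gone := proj2 (proj2 basis).

Lemma hom_basis w : f (ev w) = 0.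
Proof. by apply: (proj2 ((proj1 (proj2 basis)) _)); exists w. Qed.

Lemma kernel_reduced g : f g = 0 -> exists2 w, freduced w & ev w = g.
Proof.
case: basis => _ [gen _] /gen[w <-].
by have [v [rv ev_v _]] := freduced_exists b w; exists v.
Qed.

(** Two positive integers sum to at least 2, which exceeds the defect 1 of [tau]. *)
Lemma tau_coneM g h m k : tau_cone g m -> tau_cone h k -> tau_cone (gmul g h) (m + k).
Proof.
move=> [u [ru eu tu]] [v [rv ev_v tv]].
have [a [c [d [e1 e2 r]]]] := freduced_cancel ru rv.
exists (a ++ d); split=> //; first by rewrite -(geval_cancel b a c) -e1 -e2 eu ev_v.
have := tau_defect a c d; rewrite -e1 -e2; lia.
Qed.

Lemma tau_cone1 : ~ tau_cone gone 0.
Proof. by move=> [w [rw /(freduced_eval1 free rw) ->]]; rewrite mulr0. Qed.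

(** By parity, tau w + 2 m can vanish only for the empty word. *)
Lemma tau_cone_total g m : f g = 0 ->
  [\/ tau_cone g m, tau_cone (ginv g) (- m) | g = gone /\ m = 0].
Proof.
move=> /kernel_reduced[w rw <-].
have [lt|] := ltrP 0 (tau w + 2 * m); first by constructor 1; exists w.
rewrite le_eqVlt => /orP[/eqP e0|lt].
  constructor 3; have [w0|w0] := eqVneq w [::].
    by move: e0; rewrite w0 /=; split=> //; lia.
  by have [k ek] := tau_odd rw w0; lia.
constructor 2; exists (winv w); split; first exact: freduced_winv.
  by rewrite geval_winv.
by rewrite tau_winv; lia.
Qed.

Lemma tau_cone_kernel g m : tau_cone g m -> f g = 0.
Proof. by move=> [w [_ <- _]]; apply: hom_basis. Qed.

Lemma ext_cone_pos : is_pos_cone (fun _ => True) ext_cone.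
Proof.
have extM x y : ext_cone x -> ext_cone y -> ext_cone (gmul x y).
  case: x y => [g m] [h k] [/= g0|/= Tg] [/= h0|/= Th].
  - by left; rewrite /= hf; lia.
  - by left; rewrite /= hf (tau_cone_kernel Th); lia.
  - by left; rewrite /= hf (tau_cone_kernel Tg); lia.
  - by right; apply: tau_coneM.
have ext1 : ~ ext_cone gone.
  by case=> [|/tau_cone1 //]; rewrite /= hom1.
split=> //; split=> //; split; last first.
  by split=> // x [px /(extM _ _ px)]; rewrite gmulVr.
move=> [g m] _; have [lt|gt|e0] := ltrgt0P (f g).
- by constructor 1; left.
- by constructor 2; left; rewrite /= homV // oppr_gt0.
- have [T|T|[-> ->]] := tau_cone_total m e0.
  + by constructor 1; right.
  + by constructor 2; right.
  + by constructor 3.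
Qed.

Lemma ext_cone_lex : lex_cone f (fun g => ext_cone (g, 0)).
Proof.
exists (fun z : int => 0 < z), (fun g => tau_cone g 0); split; [|split=> //].
  split=> //; split; first by move=> x y /= lx ly; rewrite addr_gt0.
  split; last by split=> [x /=|]; [lia|rewrite /= ltxx].
  by move=> x _ /=; case: (ltrgt0P x) => [lt|lt|->];
    [constructor 1|constructor 2; rewrite oppr_gt0|constructor 3].
split; first by move=> x /tau_cone_kernel.
split; first by move=> x y Tx Ty; have := tau_coneM Tx Ty; rewrite addr0.
split; last first.
  split; last exact: tau_cone1.
  move=> x [Tx Ty]; have := tau_coneM Tx Ty; rewrite addr0 gmulVr; exact: tau_cone1.
move=> x /(@tau_cone_total _ 0)[T|T|[-> _]]; [constructor 1|constructor 2|constructor 3] => //.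
Qed.

(** * Finite automata for the extended cone *)

Variable t : G.
Hypothesis ft : f t = 1.
Local Notation letter := ('I_n * bool)%type.
(** A generator pairs a basis letter, a power t^1 or t^-1, or nothing with a shift in Z, so that an
    automaton sees both at once. *)
Local Notation gen := (option (letter + bool) * option bool)%type.

Definition gen_base (o : option (letter + bool)) : G :=
  match o with
  | None => gone
  | Some (inl l) => fletter b l
  | Some (inr s) => if s then t else ginv t
  end.

Definition gen_shift (o : option bool) : int :=
  match o with None => 0 | Some s => if s then 1 else -1 end.

Definition gen_val (x : gen) : prod_group G int_group := (gen_base x.1, gen_shift x.2).

Definition signed_power (T : Type) (x : bool -> T) k := nseq (absz k) (x (0 <= k)).

Definition base_word (w : seq letter) : seq gen := [seq (Some (inl l), None) | l <- w].
Definition t_word k : seq gen := signed_power (fun s => (Some (inr s), None)) k.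
Definition z_word k : seq gen := signed_power (fun s => (None, Some s)) k.

Lemma geval_base_word w : geval gen_val (base_word w) = (ev w, 0).
Proof. by elim: w => [|l w /= ->] //=; rewrite /gmul /= /pmul /= addr0. Qed.

Lemma geval_z_word k : geval gen_val (z_word k) = (gone, k).
Proof.
rewrite /z_word /signed_power; set s := 0 <= k.
have -> : k = gen_shift (Some s) * (absz k)%:Z by rewrite /s /=; case: ifP; lia.
have -> : absz (gen_shift (Some s) * (absz k)%:Z) = absz k by rewrite /=; case: s; lia.
elim: (absz k) => [|j IH] /=; first by rewrite mulr0.
by rewrite IH /gmul /= /pmul /= gmul1; congr (_, _); case: (s); lia.
Qed.

Lemma geval_t_word k : exists2 g, geval gen_val (t_word k) = (g, 0) & f g = k.
Proof.
rewrite /t_word /signed_power; set s := 0 <= k.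
have -> : k = gen_shift (Some s) * (absz k)%:Z by rewrite /s /=; case: ifP; lia.
have -> : absz (gen_shift (Some s) * (absz k)%:Z) = absz k by rewrite /=; case: s; lia.
elim: (absz k) => [|j [g IH eg]] /=; first by exists gone; rewrite ?hom1 ?mulr0.
rewrite IH /gmul /= /pmul /=; eexists; first by rewrite addr0.
by rewrite hf eg; case: (s); rewrite /= ?homV // ft; lia.
Qed.

(** Multiplying g on the right by an element spelled in t that cancels [f g] gives an element of F.
    If f g > 0, the resulting word contains t but not t^-1. *)
Lemma gen_val_word g m : exists w,
  geval gen_val (base_word w ++ t_word (f g) ++ z_word m) = (g, m).
Proof.
have [h eh fh] := geval_t_word (f g).
have [|w _ ew] := @kernel_reduced (gmul g (ginv h)).
  by rewrite hf homV // fh subrr.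
exists w; rewrite !geval_cat geval_base_word eh geval_z_word ew /gmul /= /pmul /=.
by rewrite gmul1r -gmulA gmulV gmul1r !add0r.
Qed.

Definition lead_dfa : dfa gen :=
  @Dfa gen (bool * bool)%type (true, false)
    (fun q x => (q.1 && (x.1 != Some (inr false)), q.2 || (x.1 == Some (inr true))))
    (fun q => q.1 && q.2).

Lemma lead_dfaP w : dfa_accepts lead_dfa w =
  all (fun x => x.1 != Some (inr false)) w && has (fun x => x.1 == Some (inr true)) w.
Proof.
rewrite /dfa_accepts.
suff H p q : foldl (@dtrans gen lead_dfa) (p, q) w =
    (p && all (fun x => x.1 != Some (inr false)) w,
     q || has (fun x => x.1 == Some (inr true)) w) by rewrite H.
elim: w p q => [|x w IH] p q /=; first by rewrite andbT orbF.
by rewrite IH andbA orbA.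
Qed.

Lemma lead_dfa_sound w : dfa_accepts lead_dfa w -> 0 < f (geval gen_val w).1.
Proof.
rewrite lead_dfaP => /andP[+ +].
have base_ge0 x : x.1 != Some (inr false) -> 0 <= f (gen_val x).1.
  case: x => [[[l|[]]|] s] //= _; rewrite ?hom1 ?ft //.
  by rewrite -[fletter b l]gmul1r (hom_basis [:: l]).
have ge0 v : all (fun x : gen => x.1 != Some (inr false)) v -> 0 <= f (geval gen_val v).1.
  elim: v => [|x v IH] /=; first by rewrite hom1.
  by move=> /andP[nx /IH ge0]; rewrite hf addr_ge0 // base_ge0.
elim: w => [|x w IH] //= /andP[nx aw] /orP[/eqP ex|hw].
  by rewrite hf ex /= ft ltr_wpDr // ge0.
by rewrite hf ltr_wpDl ?IH // base_ge0.
Qed.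

Definition tau_state := option (option (option letter)).

(** The first letter has to make tau w + 2 m positive, hence the strict inequality; later letters
    only must not decrease it. *)
Definition tau_next (o : option letter) l j :=
  match o with
  | None => 0 < eps l + 2 * gen_shift j
  | Some l' => (l != linv l') && (0 <= turn (linv l') l + eps l + 2 * gen_shift j)
  end.

Definition tau_step (q : tau_state) (x : gen) : tau_state :=
  match q, x with
  | Some _, (None, Some true) => Some None
  | Some (Some o), (Some (inl l), j) =>
      if tau_next o l j then Some (Some (Some l)) else None
  | _, _ => None
  end.

(* [Some (Some o)] is reached while reading a reduced word with last letter o,
   [Some None] once trailing positive shifts are read. The shift attached to a
   letter must compensate the change of tau, so that tau w + 2 m stays
   positive. *)
Definition tau_dfa : dfa gen :=
  @Dfa gen tau_state (Some (Some None)) tau_step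
    (fun q => (q != None) && (q != Some (Some None))).

Lemma tau_dfa_sound v : dfa_accepts tau_dfa v ->
  tau_cone (geval gen_val v).1 (geval gen_val v).2.
Proof.
suff: match foldl (dtrans (d := tau_dfa)) (dinit tau_dfa) v with
  | None => True
  | Some None => tau_cone (geval gen_val v).1 (geval gen_val v).2
  | Some (Some None) => v = [::]
  | Some (Some (Some l)) => exists w, [/\ freduced (rcons w l),
      ev (rcons w l) = (geval gen_val v).1 & 0 < tau (rcons w l) + 2 * (geval gen_val v).2]
  end.
  rewrite /dfa_accepts; case: (foldl _ _ v) => [[[l|]|]|] //=.
  by move=> [w [? ? ?]] _; exists (rcons w l).
elim/last_ind: v => [|v x IH] //; rewrite foldl_rcons geval_rcons.
case: (foldl _ _ v) IH => [q|] // IH.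
have shift0 g m : tau_cone g m -> tau_cone (gmul g gone) (m + 1).
  by rewrite gmul1r => -[w [rw ew lt]]; exists w; split=> //; lia.
case: x => [[[l|s]|] j]; first last.
- case: j => [[]|] /=; [|by case: q {IH}..].
  case: q IH => [[l|]|] /=; last exact: shift0.
    by move=> [w [rw ew lt]]; apply: shift0; exists (rcons w l).
  by move=> -> /=; exists [::]; rewrite gmul1r.
- by case: q {IH} => [[l|]|].
case: q IH => [[l'|]|] //=; last first.
  move=> -> /=; case: ifP => // lt; exists [::]; rewrite /= gmul1 gmul1r !add0r.
  by split=> //; lia.
case: ifP => // /andP[nc le] [w [rw ew lt]].
exists (rcons w l'); split.
- by rewrite -cats1 freduced_rcons_cons rw nc.
- by rewrite geval_rcons ew.
- by rewrite tau_rcons winv_rcons /=; lia.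
Qed.

(** Edge and turn contribute 1 or -1 each, so together -2, 0 or 2, which one shift cancels. *)
Lemma tau_shift (w : seq letter) (l : letter) : freduced (rcons w l) -> w != [::] ->
  exists j, oturn (ohead (winv w)) (Some l) + eps l + 2 * gen_shift j = 0.
Proof.
case/lastP: w => [//|w l']; rewrite -cats1 freduced_rcons_cons => /and3P[_ nc _] _.
rewrite winv_rcons /=; rewrite eq_sym in nc.
case: (eps_sign l) (turn_sign nc) => -> [] ->.
- by exists (Some false).
- by exists None.
- by exists None.
- by exists (Some true).
Qed.

Lemma tau_dfa_reads w l : freduced (rcons w l) -> exists v m,
  [/\ foldl tau_step (Some (Some None)) v = Some (Some (Some l)),
      geval gen_val v = (ev (rcons w l), m) & tau (rcons w l) + 2 * m = 1].
Proof.
elim/last_ind: w l => [|w l' IH] l r.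
  (* An edge of sign -1 needs the shift 1, as -1 + 2 = 1. *)
  pose j := if l.2 then None else Some true.
  exists [:: (Some (inl l), j)], (gen_shift j + 0); rewrite {}/j.
  by case: l {r} => i [].
have [rw nc] : freduced (rcons w l') /\ l != linv l'.
  by move: r; rewrite -(cats1 _ l) freduced_rcons_cons => /and3P[].
have [v [m [run val eq1]]] := IH _ rw.
have [|j ej] := tau_shift r; first by case: (w).
rewrite winv_rcons /= in ej.
exists (rcons v (Some (inl l), j)), (m + gen_shift j); split.
- by rewrite foldl_rcons run /= nc ej.
- by rewrite geval_rcons val [ev (rcons _ l)]geval_rcons.
- by rewrite tau_rcons winv_rcons /=; lia.
Qed.

Lemma tau_dfa_trail q (k : nat) : foldl tau_step (Some q) (z_word k%:Z) =
  if k is 0%N then Some q else Some None.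
Proof.
have trail i : foldl tau_step (Some None) (nseq i (None, Some true)) = Some None.
  by elim: i.
by rewrite /z_word /signed_power le0z_nat absz_nat; case: k q => [|k] [o|] //=;
  apply: trail.
Qed.

Lemma tau_dfa_complete w m : freduced w -> 0 < tau w + 2 * m ->
  exists v, dfa_accepts tau_dfa v /\ geval gen_val v = (ev w, m).
Proof.
case/lastP: w => [|w l] rw lt.
  exists (z_word m); split; last exact: geval_z_word.
  (* The successor form shows that at least one shift is read, as the initial state is not final. *)
  have -> : m = (absz m).-1.+1%:Z by move: lt => /=; lia.
  by rewrite /dfa_accepts tau_dfa_trail.
have [v [m0 [run val eq1]]] := tau_dfa_reads rw.
have [k ek] : exists k : nat, m = m0 + k%:Z by exists (absz (m - m0)); lia.
exists (v ++ z_word k); split.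
  by rewrite /dfa_accepts foldl_cat /= run tau_dfa_trail; case: (k).
by rewrite geval_cat val geval_z_word ek /gmul /= /pmul /= gmul1r.
Qed.

Lemma ext_cone_accepted x :
  ext_cone x <-> exists w,
    dfa_accepts (dfa_union lead_dfa tau_dfa) w /\ geval gen_val w = x.
Proof.
split=> [|[w [+ <-]]]; last first.
  by rewrite dfa_unionP => /orP[/lead_dfa_sound|/tau_dfa_sound]; [left|right].
case: x => [g m] [lt|[w [rw ew /(tau_dfa_complete rw)[v [av ev_v]]]]]; last first.
  by exists v; rewrite dfa_unionP av orbT ev_v ew.
rewrite [(g, m).1]/= in lt.
have [w ew] := gen_val_word g m; exists (base_word w ++ t_word (f g) ++ z_word m).
split=> //; rewrite dfa_unionP lead_dfaP; apply/orP; left.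
rewrite !all_cat !has_cat /base_word /t_word /z_word /signed_power (ltW lt).
rewrite all_map !all_nseq !has_nseq /= eqxx absz_gt0 (gt_eqF lt) /= !orbT !andbT.
by apply/allP.
Qed.

Lemma ext_cone_regular : regular_cone ext_cone.
Proof.
exists gen, gen_val; split; last first.
  by exists (dfa_union lead_dfa tau_dfa); apply: ext_cone_accepted.
by case=> g m; have [w ew] := gen_val_word g m; eexists; exact: ew.
Qed.

Lemma ext_cone_one_counter : one_counter_cone (fun g => ext_cone (g, 0)).
Proof.
apply: (@regular_one_counter _ _ _ gen_val _ _ _ ext_cone_accepted).
  by case=> [o [[]|]].
by case=> g m; have [w ew] := gen_val_word g m; eexists; exact: ew.
Qed.

End ExtendedCone.

Theorem theorem5p17 (G : group) (f : G -> int)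
  (hf : is_hom_to_Z f) (fsurj : forall z : int, exists g : G, f g = z)
  (Ffree : fg_free (fun g : G => f g = 0%R))
  (Fnonab : nonabelian (fun g : G => f g = 0%R)) :
  (forall P : G -> Prop, lex_cone f P -> ~ regular_cone P) /\
  (exists P : G -> Prop,
     lex_cone f P /\ one_counter_cone P /\
     exists Q : prod_group G int_group -> Prop,
       is_pos_cone (fun _ => True) Q /\ regular_cone Q /\
       forall g : G, P g <-> Q (g, 0%R)).
Proof.
split=> [P lexP|]; first exact: lex_cone_not_regular hf fsurj Ffree Fnonab lexP.
case: Ffree => n [b basis]; have [t ft] := fsurj 1%R.
exists (fun g => ext_cone f b (g, 0%R)).
split; first exact: ext_cone_lex.
split; first exact: (ext_cone_one_counter hf basis ft).
exists (ext_cone f b); split; first exact: ext_cone_pos.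
by split=> //; apply: (ext_cone_regular hf basis ft).
Qed.
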